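(* Let $u\in\mathcal{C}^1_p$ be an incident direction at $p\in\eta$, and let $\Pi^1_u:=u^{\perp_{\mathcal{C}^1}}\cap T_p\eta$. ''Reflected direction'' means reflected direction associated with $u$. When $u$ is $\mathcal{C}^1$-transverse to $\eta$: (A$^*$) If $T_p\eta$ is $\mathcal{C}^1$-timelike, then $\Pi^1_u$ cannot be $\mathcal{C}^1$-timelike and: (i) if $\Pi^1_u$ is $\mathcal{C}^1$-spacelike, there exists a unique reflected direction, necessarily transverse to $\eta$; (ii) if $\Pi^1_u$ is $\mathcal{C}^1$-lightlike, there exists a unique reflected direction, necessarily tangent to $\eta$, which coincides with $u$. (B$^*$) If $T_p\eta$ is $\mathcal{C}^1$-lightlike, there exists a unique reflected direction, necessarily tangent to $\eta$. (C$^*$) If $T_p\eta$ is $\mathcal{C}^1$-spacelike, there are no reflected directions. Otherwise, when $u^{\perp_{\mathcal{C}^1}}=T_p\eta$, there exists a unique reflected direction, necessarily tangent to $\eta$, which coincides with $u$.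
   Context: Cone structures. A cone structure on a manifold $Q$ is a (smooth, embedded) hypersurface $\mathcal{C}$ of $TQ\setminus\mathbf{0}$ such that for each $p\in Q$: (i) $\mathcal{C}$ is transverse to the fibers of $TQ$, i.e. for $v\in\mathcal{C}_p:=T_pQ\cap\mathcal{C}$, $T_v(T_pQ)+T_{(p,v)}\mathcal{C}=T_{(p,v)}(TQ)$; (ii) $\mathcal{C}_p$ is conic ($v\in\mathcal{C}_p\Rightarrow\lambda v\in\mathcal{C}_p$ for all $\lambda>0$), salient ($v\in\mathcal{C}_p\Rightarrow -v\notin\mathcal{C}_p$), is the boundary in $T_pQ\setminus\{0\}$ of an open convex subset $A_p\subset T_pQ\setminus\{0\}$, and is (non-radially) strongly convex: the second fundamental form of $\mathcal{C}_p$ as an affine hypersurface of $T_pQ$ is positive semi-definite (with respect to an inner direction pointing to $A_p$) with radical at each $v\in\mathcal{C}_p$ spanned by the radial direction of $v$. Causality. A vector $v\in T_pQ$ is timelike if $v\in A_p$, lightlike if $v\in\mathcal{C}_p$, causal if $v\in A_p\cup\mathcal{C}_p$, spacelike if neither $v$ nor $-v$ is causal. A linear subspace $\Pi\subset T_pQ$ is timelike if it contains a timelike vector, lightlike if it is tangent to $\mathcal{C}_p$ along one radial direction $v\in\mathcal{C}_p$ (i.e. $v\in\Pi\subset T_v\mathcal{C}_p$), spacelike if all its vectors are spacelike. The prefix ''$\mathcal{C}$-'' specifies the cone structure. Orthogonality. For $v\in\mathcal{C}_p$, $v^{\perp_{\mathcal{C}}}:=T_v\mathcal{C}_p$ (a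 hyperplane of $T_pQ$); $v\perp_{\mathcal{C}}\Pi$ means $\Pi\subset v^{\perp_{\mathcal{C}}}$. Setting. $Q$ is a smooth manifold of dimension $n+1\ge3$; $\eta$ is a smooth embedded hypersurface dividing $Q$ into two open subsets $Q_1,Q_2$ whose closures $\overline{Q}_1,\overline{Q}_2$ (with union $Q$) are smooth manifolds with common boundary $\eta$. $\mathcal{C}^1$ is a cone structure on $\overline{Q}_1$ (smoothly extendable slightly beyond $\eta$). Directions. For $p\in\eta$, $Q^1_p,Q^2_p\subset T_pQ$ are the two open half-spaces of $T_pQ\setminus T_p\eta$, $Q^\mu_p$ being the one on the $Q_\mu$-side. A direction $v$ means the half-ray $\{\lambda v:\lambda>0\}$ (uniqueness and coincidence of directions is up to positive rescaling). A vector $v\in T_pQ$ is transverse to $\eta$ if $v\notin T_p\eta$; $r\in\mathcal{C}^1_p$ is $\mathcal{C}^1$-transverse to $\eta$ if $r^{\perp_{\mathcal{C}^1}}\ne T_p\eta$. For $r\in\mathcal{C}^1_p$ put $\Pi^1_r:=r^{\perp_{\mathcal{C}^1}}\cap T_p\eta$. An incident direction at $p$ is $u\in\mathcal{C}^1_p$ with $u\in Q^2_p\cup T_p\eta$. A reflected direction associated with $u$ is $w\in\mathcal{C}^1_p$ with $w\in Q^1_p\cup T_p\eta$ and $\Pi^1_u\subset\Pi^1_w$ (i.e. $w\perp_{\mathcal{C}^1}\Pi^1_u$). *)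

(* Defs.v *)
From HB Require Import structures.
From mathcomp Require Import all_boot all_order all_algebra.
From mathcomp Require Import all_classical all_reals all_analysis.
Set Implicit Arguments.
Unset Strict Implicit.
Unset Printing Implicit Defensive.
Import Order.TTheory GRing.Theory Num.Theory.
Import numFieldNormedType.Exports.
Local Open Scope classical_set_scope.
Local Open Scope ring_scope.

Definition iter_derive (R : realType) (V W : normedModType R)
    (s : seq V) (f : V -> W) : V -> W :=
  foldr (fun v g => 'D_v g) f s.

(* In finite dimension this is C^oo on the open set [O]: iterated partial
   derivatives of all orders exist and are differentiable, hence continuous. *)
Definition smooth_on (R : realType) (V W : normedModType R)
    (O : set V) (f : V -> W) : Prop :=
  forall (s : seq V) (x : V), O x -> differentiable (iter_derive s f) x.

Definition local_equation (R : realType) (V : normedModType R)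
    (S : set V) (z : V) (O : set V) (F : V -> R) : Prop :=
  [/\ open O, O z, smooth_on O F,
      (forall x, O x -> (S x <-> F x = 0)) &
      exists X, 'd F z X != 0].

Definition hypersurface (R : realType) (V : normedModType R) (S : set V) :=
  forall z, S z -> exists O F, local_equation S z O F.

(* T_z S = ker dF_z; this kernel is the same for all local equations F of S
   at z. *)
Definition tangent (R : realType) (V : normedModType R)
    (S : set V) (z : V) : set V :=
  [set X | exists O F, local_equation S z O F /\ 'd F z X = 0].

(* [h] is the second fundamental form of the affine hypersurface [S] at [v]
   with respect to the transverse direction [xi], i.e. Gauss' formula
     D_X Y = (tangent part) + h(X, Y) xi
   holds for all vector fields [Yt] tangent to [S] and extending [Y].  Only
   the first derivative of [Yt] at [v] matters, so differentiability at [v]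
   is all that is asked of [Yt].  The values of [h] outside the tangent space
   are irrelevant. *)
Definition second_fundamental_form (R : realType) (V : normedModType R)
    (S : set V) (v xi : V) (h : V -> V -> R) : Prop :=
  forall (X Y : V) (Yt : V -> V),
    tangent S v X -> tangent S v Y ->
    differentiable Yt v -> Yt v = Y ->
    (\forall x \near v, S x -> tangent S x (Yt x)) ->
    tangent S v ('d Yt v X - h X Y *: xi).

Definition inner_direction (R : realType) (V : normedModType R)
    (S A : set V) (v xi : V) : Prop :=
  ~ tangent S v xi /\ \forall t \near (0 : R)^'+, A (v + t *: xi).

Definition strongly_convex_cone_at (R : realType) (V : normedModType R)
    (S A : set V) (v : V) : Prop :=
  exists xi h,
    [/\ inner_direction S A v xi,
        second_fundamental_form S v xi h,
        (forall X, tangent S v X -> 0 <= h X X) &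
        (forall X, tangent S v X ->
           ((forall Y, tangent S v Y -> h X Y = 0) <->
            exists c : R, X = c *: v))].

(* The values of [cmap] outside [cdom], and of [cinv] outside the image of
   [cdom], are irrelevant. *)
Record chart (R : realType) (m : nat) (T : topologicalType) := Chart {
  cdom : set T;
  cmap :> T -> 'rV[R]_m;
  cinv : 'rV[R]_m -> T }.

Definition chart_image (R : realType) (m : nat) (T : topologicalType)
    (phi : chart R m T) (S : set T) : set 'rV[R]_m :=
  [set phi x | x in S `&` cdom phi].

Definition chart_axiom (R : realType) (m : nat) (T : topologicalType)
    (phi : chart R m T) : Prop :=
  [/\ open (cdom phi), open (chart_image phi setT),
      (forall x, cdom phi x -> cinv phi (phi x) = x),
      {within cdom phi, continuous phi} &
      {within chart_image phi setT, continuous (cinv phi)}].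

Record smooth_manifold (R : realType) (m : nat) := SmoothManifold {
  carrier :> topologicalType;
  atlas : set (chart R m carrier);
  chart_at : carrier -> chart R m carrier;
  _ : hausdorff_space carrier;
  _ : @second_countable carrier;
  _ : forall phi, atlas phi -> chart_axiom phi;
  _ : forall phi psi, atlas phi -> atlas psi ->
        smooth_on (chart_image phi (cdom psi)) (psi \o cinv phi);
  _ : forall p, atlas (chart_at p) /\ cdom (chart_at p) p }.

Section Manifold.
Context {R : realType} {m : nat} {Q : smooth_manifold R m}.
Local Notation V := 'rV[R]_m.

(* A tangent vector at [p] is represented by its coordinates in the preferred
   chart [chart_at p], which identifies T_p Q with 'rV_m; [chart_vector phi p v]
   gives the coordinates of the same vector in the chart [phi], so that
   [(p, v) |-> (phi p, chart_vector phi p v)] is the chart of TQ induced by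
   [phi]. *)
Definition chart_vector (phi : chart R m Q) (p : Q) (v : V) : V :=
  'd (phi \o cinv (chart_at p)) (chart_at p p) v.

(* Image, in the chart of TQ induced by [phi], of the part over [W] of the
   subset of TQ with fibers [C p]. *)
Definition bundle_image (phi : chart R m Q) (W : set Q) (C : Q -> set V) :
    set (V * V) :=
  [set z | exists p v, [/\ W p, cdom phi p, C p v &
                           z = (phi p, chart_vector phi p v)]].

Definition embedded_hypersurface (eta : set Q) : Prop :=
  forall phi : chart R m Q, atlas phi -> hypersurface (chart_image phi eta).

Definition tangent_at (eta : set Q) (p : Q) : set V :=
  tangent (chart_image (chart_at p) eta) (chart_at p p).

(* [D] is a smooth manifold with boundary [eta], of full dimension in [Q]:
   it is locally {F <= 0} near the points of [eta] = {F = 0}, dF <> 0. *)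
Definition smooth_domain (D eta : set Q) : Prop :=
  [/\ eta `<=` D, D `\` eta `<=` interior D &
      forall (phi : chart R m Q) (p : Q), atlas phi -> cdom phi p -> eta p ->
        exists O F, local_equation (chart_image phi eta) (phi p) O F /\
          forall x, O x -> (chart_image phi D x <-> F x <= 0)].

Definition divides (eta Q1 Q2 : set Q) : Prop :=
  [/\ embedded_hypersurface eta,
      open Q1 /\ open Q2,
      Q1 `&` Q2 = set0 /\ Q1 `|` Q2 = ~` eta,
      closure Q1 `|` closure Q2 = setT &
      smooth_domain (closure Q1) eta /\ smooth_domain (closure Q2) eta].

(* The open half-space of T_p Q \ T_p eta on the side of [U]. *)
Definition half_space (eta U : set Q) (p : Q) : set V :=
  [set v | ~ tangent_at eta p v /\
    \forall t \near (0 : R)^'+,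
      chart_image (chart_at p) U (chart_at p p + t *: v)].

(* [A] is the open convex set bounded by the fiber [C] of a cone structure; a
   cone structure below is given by its fibers [C p] together with the [A p]. *)
Definition cone_fiber (C A : set V) : Prop :=
  [/\ (forall v (l : R), C v -> 0 < l -> C (l *: v)),
      (forall v, C v -> ~ C (- v)),
      [/\ open A, convex_set A & ~ A 0],
      C = [set v | [/\ v != 0, closure A v & ~ A v]] &
      (forall v, C v -> strongly_convex_cone_at C A v)].

(* Cone structure on the open submanifold [W]. *)
Definition cone_structure_on (W : set Q) (C A : Q -> set V) : Prop :=
  [/\ (forall phi : chart R m Q, atlas phi ->
         hypersurface (bundle_image phi W C)),
      (* transversality to the fibers of TQ *)
      (forall (phi : chart R m Q) z, atlas phi -> bundle_image phi W C z ->
         forall X : V * V, exists (Y : V) (Z : V * V),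
           tangent (bundle_image phi W C) z Z /\ X = (0, Y) + Z) &
      forall p, W p -> cone_fiber (C p) (A p)].

(* Cone structure on the submanifold with boundary [D]: the restriction of
   a cone structure defined slightly beyond [D]. *)
Definition extendable_cone_structure_on (D : set Q) (C A : Q -> set V) : Prop :=
  exists W C' A', [/\ open W, D `<=` W, cone_structure_on W C' A' &
    forall p, D p -> C' p = C p /\ A' p = A p].

End Manifold.

(* In this section [V] is one tangent space, [C] the cone in it and [A] the
   convex set it bounds. *)

Section Causality.
Context {R : realType} {V : normedModType R}.
Implicit Types (C A Pi : set V) (u v w : V).

Definition timelike A v : Prop := A v.
Definition lightlike C v : Prop := C v.
Definition causal C A v : Prop := timelike A v \/ lightlike C v.
Definition spacelike C A v : Prop := ~ causal C A v /\ ~ causal C A (- v).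

Definition timelike_subspace A Pi : Prop := exists2 v, Pi v & timelike A v.
Definition lightlike_subspace C Pi : Prop :=
  exists v, [/\ lightlike C v, Pi v & Pi `<=` tangent C v].
Definition spacelike_subspace C A Pi : Prop :=
  forall v, Pi v -> spacelike C A v.

Definition orthogonal_complement C v : set V := tangent C v.
Definition orthogonal C v Pi : Prop := Pi `<=` orthogonal_complement C v.

(* Equality of the half-rays spanned by [v] and [w]. *)
Definition same_direction v w : Prop := exists2 l : R, 0 < l & w = l *: v.

Definition exists_unique_direction (P : V -> Prop) : Prop :=
  exists2 w, P w & forall w', P w' -> same_direction w w'.

End Causality.

Section Reflection.
Context {R : realType} {m : nat} {Q : smooth_manifold R m}.
Local Notation V := 'rV[R]_m.
Implicit Types (eta : set Q) (C : Q -> set V) (p : Q) (r u w : V).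

Definition cone_transverse eta C p r : Prop :=
  orthogonal_complement (C p) r <> tangent_at eta p.

Definition hypersurface_trace eta C p r : set V :=
  orthogonal_complement (C p) r `&` tangent_at eta p.

Definition incident_direction eta (Q2 : set Q) C p u : Prop :=
  C p u /\ (half_space eta Q2 p u \/ tangent_at eta p u).

Definition reflected_direction eta (Q1 : set Q) C p u w : Prop :=
  [/\ C p w, half_space eta Q1 p w \/ tangent_at eta p w &
      orthogonal (C p) w (hypersurface_trace eta C p u)].

End Reflection.

(* Main.v *)
(* At p everything takes place in the tangent space.  The fiber C is a
   hypersurface (restrict a local equation of the bundle to the fiber), K, the
   closure of A, is a closed salient convex cone, and the tangent hyperplane at
   v in C is the kernel of a linear form l_v which is positive on A.  By strong
   convexity l_v vanishes on K only along the ray of v.  Write T_p eta = ker g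
   with g > 0 on the side of Q_1, so that g u <= 0; the reflected directions are
   the w in C with g w >= 0 and l_w in the span of l_u and g.  When ker g meets
   A and g u < 0, these are the maximizers of g / l_u on the part of K where
   g >= 0, unique up to scaling by strong convexity; when g u = 0, u lies in
   ker l_u and ker g, so l_w u = 0, and u is the only solution.  If ker g is
   tangent to C or misses K, g has a sign on K. *)
Require Import Defs.
From mathcomp Require Import all_boot all_order all_algebra.
From mathcomp Require Import all_classical all_reals all_analysis.
From mathcomp Require Import ring lra.
Set Implicit Arguments.
Unset Strict Implicit.
Unset Printing Implicit Defensive.
Import Order.TTheory GRing.Theory Num.Theory.
Import numFieldNormedType.Exports.
Local Open Scope classical_set_scope.
Local Open Scope ring_scope.

(** * Tangent spaces of hypersurfaces given by local equations *)

Section Tangent.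
Context {R : realType} {V : normedModType R}.
Implicit Types (S O : set V) (F G : V -> R) (z X Y : V).

Lemma differentiable_near (F : V -> R) z (e : R) :
  differentiable F z -> 0 < e ->
  exists2 d : R, 0 < d & forall h, `|h| < d ->
    `|F (z + h) - F z - 'd F z h| <= e * `|h|.
Proof.
move=> dF e0; have := diff_locally dF => /eqaddoP /(_ e e0).
move=> /nbhs_normP[d /= d0 H]; exists d => // h hd.
have := H h; rewrite /= sub0r normrN => /(_ hd).
by rewrite /= !fctE opprD addrA [h + z]addrC.
Qed.

Lemma local_equation_differentiable S z O F :
  local_equation S z O F -> forall x, O x -> differentiable F x.
Proof. by case=> _ _ smF _ _ x Ox; exact: (smF [::]). Qed.

Lemma local_equation_val S z O F : local_equation S z O F -> S z -> F z = 0.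
Proof. by case=> _ Oz _ HS _ /(HS _ Oz). Qed.

(* The intermediate value theorem along [Y] replaces the implicit function
   theorem. *)
Lemma local_equation_curve S z O F X Y (e : R) :
  local_equation S z O F -> S z -> 'd F z X = 0 -> 'd F z Y != 0 -> 0 < e ->
  \forall t \near 0^'+, exists2 s : R, `|s| <= e & S (z + t *: (X + s *: Y)).
Proof.
move=> eqF Sz dX.
suff pos Y' : 0 < 'd F z Y' -> 0 < e ->
    \forall t \near 0^'+, exists2 s : R, `|s| <= e & S (z + t *: (X + s *: Y')).
  move=> dY e0; have := dY; rewrite neq_lt => /orP[dY0|dY0]; last exact: pos.
  have dNY : 0 < 'd F z (- Y) by rewrite linearN oppr_gt0.
  apply: filterS (pos _ dNY e0) => t [s se Ss].
  by exists (- s); rewrite ?normrN // scaleNr -scalerN.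
clear Y; move: Y' => Y; set c := 'd F z Y => c0 e0.
have [opO Oz _ HS _] := eqF.
have dF x (Ox : O x) := local_equation_differentiable eqF Ox.
have Fz := local_equation_val eqF Sz.
pose M := `|X| + e * `|Y| + 1.
have M0 : 0 < M by rewrite ltr_wpDl // addr_ge0 // mulr_ge0 // ltW.
(* [M] bounds the norm of [X + s *: Y] for all admissible [s], so this tolerance keeps the error of
   the first-order term [t * (s * c)] below [t * (e * c)]: [F] changes sign weakly between [s = - e]
   and [s = e]. *)
have e'0 : 0 < e * c / M by rewrite divr_gt0 // mulr_gt0.
have [d1 d10 H1] := differentiable_near (dF _ Oz) e'0.
have /nbhs_normP[d2 /= d20 H2] : nbhs z O by exact: open_nbhs_nbhs.
have d0 : 0 < Num.min d1 d2 / M by rewrite divr_gt0 // lt_min d10.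
near=> t.
have t0 : 0 < t by [].
have tM : t * M < Num.min d1 d2 by rewrite -ltr_pdivlMr.
have hM s : `|s| <= e -> `|t *: (X + s *: Y)| <= t * M.
  move=> se; rewrite normrZ gtr0_norm // ler_wpM2l ?(ltW t0) //.
  rewrite (le_trans (ler_normD _ _)) // /M -addrA lerD2l normrZ.
  by rewrite ler_wpDr // ler_wpM2r.
have Oh s : `|s| <= e -> O (z + t *: (X + s *: Y)).
  move=> /hM h; apply: H2; rewrite /= opprD addNKr normrN.
  by apply: le_lt_trans h _; move: tM; rewrite lt_min => /andP[].
have Fh s : `|s| <= e -> `|F (z + t *: (X + s *: Y)) - t * (s * c)| <= t * (e *
  c).
  move=> /hM h; have hd : `|t *: (X + s *: Y)| < d1.
    by apply: le_lt_trans h _; move: tM; rewrite lt_min => /andP[].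
  have := H1 _ hd.
  have -> : 'd F z (t *: (X + s *: Y)) = t * (s * c).
    by rewrite [LHS]linearZ [in LHS]linearD linearZ /= dX add0r.
  rewrite Fz subr0 => /le_trans; apply.
  apply: le_trans (ler_wpM2l (ltW e'0) h) _.
  by rewrite mulrCA divfK ?gt_eqF.
have ee : `|e| <= e by rewrite gtr0_norm.
have eNe : `|- e| <= e by rewrite normrN.
have [s sI Fs] : exists2 s, s \in `[- e, e] & F (z + t *: (X + s *: Y)) = 0.
  apply: (@IVT R (fun s => F (z + t *: (X + s *: Y)))).
  - by rewrite ge0_cp // ltW.
  - apply: continuous_in_subspaceT => s;
      rewrite inE /= in_itv /= -ler_norml => se.
    have cl : {for s, continuous (fun s : R => z + t *: (X + s *: Y))}.
      apply: cvgD; first exact: cvg_cst.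
      apply: cvgZr; apply: cvgD; first exact: cvg_cst.
      exact: cvgZl.
    exact: continuous_comp cl (differentiable_continuous (dF _ (Oh _ se))).
  - have := Fh _ ee; have := Fh _ eNe.
    rewrite !ler_norml => /andP[a1 a2] /andP[b1 b2].
    rewrite ge_min le_max; apply/andP; split; apply/orP; [left|right]; lra.
move: sI; rewrite in_itv /= -ler_norml => se.
by exists s => //; apply/(HS _ (Oh _ se)).
Unshelve. all: by end_near. Qed.

(** [S] contains points [z + t *: (X + s *: Y)] with [s] as small as desired. [G] vanishes there, so
    its expansion at [z] makes ['d G z X + s * 'd G z Y] small, hence also ['d G z X]. *)
Lemma local_equation_tangent_sub S z O F O' G X :
  local_equation S z O F -> local_equation S z O' G -> S z ->
  'd F z X = 0 -> 'd G z X = 0.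
Proof.
move=> eqF eqG Sz dX.
have [Y dY] : exists Y, 'd F z Y != 0 by case: eqF.
apply/eqP; rewrite -normr_le0; apply/ler_addgt0Pl => a a0; rewrite addr0.
have [opO' O'z _ HS' _] := eqG.
have dG x (Ox : O' x) := local_equation_differentiable eqG Ox.
have Gz := local_equation_val eqG Sz.
pose b := `|'d G z Y|.
pose M := `|X| + `|Y| + 1.
have M0 : 0 < M by rewrite ltr_wpDl // addr_ge0.
(* The bound 1 keeps [X + s *: Y] of norm at most [M]; the other one makes the contribution of
   [s *: Y] at most [a / 2]. *)
pose e := Num.min 1 (a / 2 / (b + 1)).
have b1 : 0 < b + 1 by rewrite ltr_wpDl // normr_ge0.
have e0 : 0 < e by rewrite lt_min ltr01 /= divr_gt0 // divr_gt0.
have e'0 : 0 < a / 2 / M by rewrite divr_gt0 // divr_gt0.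
have [d1 d10 H1] := differentiable_near (dG _ O'z) e'0.
have /nbhs_normP[d2 /= d20 H2] : nbhs z O' by exact: open_nbhs_nbhs.
have d0 : 0 < Num.min d1 d2 / M by rewrite divr_gt0 // lt_min d10.
have cu := local_equation_curve eqF Sz dX dY e0.
near (0 : R)^'+ => t.
have t0 : 0 < t by [].
have tM : t * M < Num.min d1 d2 by rewrite -ltr_pdivlMr.
have [s se Ss] : exists2 s : R, `|s| <= e & S (z + t *: (X + s *: Y))
  by near: t.
have [s1 sb] : `|s| <= 1 /\ `|s| <= a / 2 / (b + 1).
  by move: se; rewrite le_min => /andP[].
have hM : `|t *: (X + s *: Y)| <= t * M.
  rewrite normrZ gtr0_norm // ler_wpM2l ?(ltW t0) //.
  rewrite (le_trans (ler_normD _ _)) // /M -addrA lerD2l normrZ.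
  by rewrite ler_wpDr // ler_piMl.
move: tM; rewrite lt_min => /andP[tM1 tM2].
have Oh : O' (z + t *: (X + s *: Y)).
  by apply: H2; rewrite /= opprD addNKr normrN (le_lt_trans hM).
have := H1 _ (le_lt_trans hM tM1).
have /(HS' _ Oh) -> := Ss.
have -> : 'd G z (t *: (X + s *: Y)) = t * ('d G z X + s * 'd G z Y).
  by rewrite [LHS]linearZ [in LHS]linearD linearZ.
rewrite Gz subr0 sub0r normrN normrM gtr0_norm // => h.
have {}h : `|'d G z X + s * 'd G z Y| <= a / 2.
  rewrite -(ler_pM2l t0); apply: le_trans h _.
  apply: le_trans (ler_wpM2l (ltW e'0) hM) _.
  by rewrite mulrCA divfK ?gt_eqF.
have hs : `|s * 'd G z Y| <= a / 2.
  rewrite normrM -/b; apply: le_trans (_ : a / 2 / (b + 1) * (b + 1) <= _).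
    by apply: ler_pM; rewrite ?normr_ge0 // lerDl.
  by rewrite divfK ?gt_eqF.
rewrite -['d G z X](addrK (s * 'd G z Y)).
by rewrite (le_trans (ler_normB _ _)) // [leRHS]splitr lerD.
Unshelve. all: by end_near. Qed.

Lemma tangentP S z O F X : local_equation S z O F -> S z ->
  tangent S z X <-> 'd F z X = 0.
Proof.
move=> eqF Sz; split=> [[U [G [eqG]]]|dX]; last by exists O, F.
exact: local_equation_tangent_sub eqG eqF Sz.
Qed.

End Tangent.

(** * Slices of a hypersurface of a product *)

Section Slice.
Context {R : realType} {V1 V2 : normedModType R}.
Implicit Types (S O : set (V1 * V2)) (F : V1 * V2 -> R) (c : V1) (y : V2).

Lemma is_diff_pair_cst c y :
  is_diff y (fun y : V2 => (c, y)) (fun v : V2 => (0, v)).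
Proof. exact: (@is_diff_pair _ _ _ _ (cst c) 0 id id). Qed.

Lemma differentiable_slice F c y :
  differentiable F (c, y) -> differentiable (fun y => F (c, y)) y.
Proof.
by move=> dF; apply: (@differentiable_comp _ _ _ _ (fun y => (c, y)) F).
Qed.

Lemma diff_slice F c y (Y : V2) : differentiable F (c, y) ->
  'd (fun y => F (c, y)) y Y = 'd F (c, y) (0, Y).
Proof.
move=> dF; have [dg dgE] := is_diff_pair_cst c y.
have := @diff_comp _ _ _ _ (fun y => (c, y)) F y dg dF.
by move=> ->; rewrite /= dgE.
Qed.

(** A vertical direction [(0, v)] leaves the first coordinate fixed, so the difference quotients
    agree. This carries smoothness over to slices. *)
Lemma iter_derive_slice F c (s : seq V2) :
  iter_derive s (fun y => F (c, y)) =
  fun y => iter_derive [seq (0, v) | v <- s] F (c, y).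
Proof.
elim: s => // v s IHs; apply/funext => y; rewrite /= -/(iter_derive _ _) IHs.
rewrite /derive; set f := (X in lim (X @ _)); set g := (X in _ = lim (X @ _)).
suff -> : f = g by [].
apply/funext => h; rewrite /f /g /=.
by congr (_ *: (iter_derive _ _ (_, _) - _)); rewrite /= scaler0 add0r.
Qed.

Lemma local_equation_slice S O F c y : local_equation S (c, y) O F ->
  (exists Y, 'd F (c, y) (0, Y) != 0) ->
  local_equation [set y | S (c, y)] y [set y | O (c, y)] (fun y => F (c, y)).
Proof.
move=> eqF [Y dY]; have [opO Oz smF HS _] := eqF; split=> //=.
- apply: (@open_comp _ _ (fun y => (c, y)) O) => // x _.
  by apply: differentiable_continuous; case: (is_diff_pair_cst c x).
- move=> s x Ox; rewrite iter_derive_slice.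
  exact/differentiable_slice/smF.
- by move=> x Ox; exact: HS.
- by exists Y; rewrite diff_slice //; exact: (smF [::]).
Qed.

(** Split a vector on which ['d F] is nonzero into a vertical and a tangent part: ['d F] kills the
    latter, so it is nonzero on the vertical part and the restricted equation is still regular. *)
Lemma hypersurface_slice S c :
  hypersurface S ->
  (forall z, S z -> forall X : V1 * V2, exists (Y : V2) (Z : V1 * V2),
     tangent S z Z /\ X = (0, Y) + Z) ->
  hypersurface [set y | S (c, y)].
Proof.
move=> hS tS y /= Sy; have [U [F eqF]] := hS _ Sy.
exists [set y | U (c, y)], (fun y => F (c, y));
  apply: local_equation_slice => //.
have [_ _ _ _ [X dX]] := eqF; have [Y [Z [tZ XE]]] := tS _ Sy X.
exists Y; move: dX; rewrite XE linearD.
by have /(tangentP _ eqF Sy) -> := tZ; rewrite addr0.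
Qed.

End Slice.

(** * From the cone bundle to its fiber at one point *)

Section Fiber.
Context {R : realType} {m : nat} {Q : smooth_manifold R m}.
Implicit Types (C A : Q -> set 'rV[R]_m) (p : Q).

Lemma atlas_chart_axiom (phi : chart R m Q) : atlas phi -> chart_axiom phi.
Proof. by case: Q phi => /= T at_ ca hd sc ax tr cp phi /ax. Qed.

Lemma atlas_transition (phi psi : chart R m Q) : atlas phi -> atlas psi ->
  smooth_on (chart_image phi (cdom psi)) (psi \o cinv phi).
Proof. by case: Q phi psi => /= T at_ ca hd sc ax tr cp phi psi; exact: tr. Qed.

Lemma atlas_chart_at p : atlas (chart_at p).
Proof. by case: Q p => /= T at_ ca hd sc ax tr cp p; have [] := cp p. Qed.

Lemma cdom_chart_at p : cdom (chart_at p) p.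
Proof. by case: Q p => /= T at_ ca hd sc ax tr cp p; have [] := cp p. Qed.

Lemma chart_inj (phi : chart R m Q) p q : atlas phi ->
  cdom phi p -> cdom phi q -> phi p = phi q -> p = q.
Proof.
by move=> /atlas_chart_axiom[_ _ ck _ _] dp dq e; rewrite -(ck _ dp) e ck.
Qed.

(** Near the image of [p], the preferred chart composed with its inverse is the identity. *)
Lemma chart_vector_at p (v : 'rV[R]_m) : chart_vector (chart_at p) p v = v.
Proof.
have ax := atlas_chart_axiom (atlas_chart_at p).
have [_ opI ck _ _] := ax.
have nearid : \forall x \near chart_at p p, chart_at p (cinv (chart_at p) x) =
  x.
  have : nbhs (chart_at p p) (chart_image (chart_at p) setT).
    apply: open_nbhs_nbhs; split=> //; exists p => //; split=> //.
    exact: cdom_chart_at.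
  by apply: filterS => _ [q [_ dq] <-]; rewrite ck.
rewrite /chart_vector -deriveE; last first.
  apply: (atlas_transition (atlas_chart_at p) (atlas_chart_at p) [::]).
  by exists p => //; split; exact: cdom_chart_at.
rewrite (@near_eq_derive _ _ _ _ id); last exact: nearid.
exact: derive_id.
Qed.

(** In the preferred chart at [p], the fiber is the slice of the bundle image over [chart_at p p];
    injectivity of the chart excludes vectors based elsewhere. *)
Lemma cone_structure_fiber (W : set Q) C A p : cone_structure_on W C A -> W p ->
  hypersurface (C p) /\ cone_fiber (C p) (A p).
Proof.
move=> [hC tC fC] Wp; split; last exact: fC.
have aphi := atlas_chart_at p.
suff <- : [set v | bundle_image (chart_at p) W C (chart_at p p, v)] = C p.
  by apply: hypersurface_slice; [exact: hC|move=> z; exact: tC].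
apply/seteqP; split=> v /=.
  move=> [q [w [Wq dq Cw [e ->]]]].
  have qp := chart_inj aphi dq (cdom_chart_at p) (esym e).
  by move: Cw; rewrite qp chart_vector_at.
move=> Cv; exists p, v; split => //; first exact: cdom_chart_at.
by rewrite chart_vector_at.
Qed.

End Fiber.

(** * Linear forms and inclusions between their kernels *)

Section LinearForms.
Context {R : fieldType} {V : lmodType R}.
Implicit Types (f g l : {linear V -> R^o}).

Lemma formZ f (a : R) x : f (a *: x) = a * f x :> R.
Proof. by rewrite linearZ. Qed.

Lemma formD f x y : f (x + y) = f x + f y :> R.
Proof. by rewrite linearD. Qed.

Lemma formB f x y : f (x - y) = f x - f y :> R.
Proof. by rewrite linearB. Qed.

Lemma formBZ f (a b : R) x y : f (a *: x - b *: y) = a * f x - b * f y :> R.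
Proof. by rewrite formB [f (a *: x)]formZ [f (b *: y)]formZ. Qed.

Lemma linear_ker_sub f g : (exists x, f x != 0) ->
  (forall x, f x = 0 -> g x = 0) -> exists c : R, forall x, g x = c * f x.
Proof.
move=> [e fe] fg; exists (g e / f e) => x.
have : f (x - (f x / f e) *: e) = 0 by rewrite formB formZ divfK // subrr.
move/fg; rewrite formB formZ => /eqP; rewrite subr_eq0 => /eqP ->.
by rewrite mulrAC [RHS]mulrAC [f x * _]mulrC.
Qed.

Lemma linear_ker2_sub f g l : (exists2 x, g x = 0 & f x != 0) ->
  (exists x, g x != 0) -> (forall x, f x = 0 -> g x = 0 -> l x = 0) ->
  exists a b : R, forall x, l x = a * f x + b * g x.
Proof.
move=> [e ge fe] [d gd] fgl; pose a := l e / f e.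
pose b := (l d - a * f d) / g d; exists a, b => x.
(* Project [x] along [d] into the kernel of [g], then along [e], which stays in that kernel, into
   the kernel of [f]; [l] vanishes on the result. *)
pose y := x - (g x / g d) *: d; pose z := y - (f y / f e) *: e.
have gy : g y = 0 by rewrite /y formB formZ divfK // subrr.
have gz : g z = 0 by rewrite /z formB formZ gy ge mulr0 subr0.
have fz : f z = 0 by rewrite /z formB formZ divfK // subrr.
have alg (lx fx gx le ld fe' fd gd' : R) : fe' != 0 -> gd' != 0 ->
    lx - gx / gd' * ld - (fx - gx / gd' * fd) / fe' * le = 0 ->
    lx = le / fe' * fx + (ld - le / fe' * fd) / gd' * gx.
  move=> fe0 gd0 H; apply/eqP; rewrite -subr_eq0; apply/eqP; rewrite -[RHS]H.
  by field; rewrite fe0 gd0.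
by apply: alg; rewrite // -!(formB, formZ) fgl.
Qed.

End LinearForms.

(** * First-order arguments along rays *)

Section Ray.
Context {R : realType} {V : normedModType R}.

Lemma continuous_line (a x : V) : continuous (fun t : R => a + t *: x).
Proof.
move=> t; have tt : (fun t : R => t *: x) @ t --> t *: x
  by exact: (cvgZr_tmp cvg_id).
exact: (cvgD (cvg_cst a) tt).
Qed.

Lemma open_line (U : set V) (a x : V) : open U -> U a ->
  \forall t \near (0 : R)^'+, U (a + t *: x).
Proof.
move=> opU Ua; have nU : nbhs (a + 0 *: x) U.
  by rewrite scale0r addr0; exact: open_nbhs_nbhs.
have n0 : \forall t \near (0 : R), U (a + t *: x)
  by exact: (continuous_line nU).
by near=> t; near: t; exact: cvg_within n0.
Unshelve. all: by end_near. Qed.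

Lemma continuous_homothety (a : V) (c : R) : continuous (fun x : V => a + c *:
  x).
Proof.
move=> x; have xx : (fun x : V => c *: x) @ x --> c *: x
  by exact: (cvgZl_tmp cvg_id).
exact: (cvgD (cvg_cst a) xx).
Qed.

Lemma le0_eps (x b : R) : (forall e, 0 < e -> x <= e * b) -> x <= 0.
Proof.
move=> H; rewrite leNgt; apply/negP => x0.
have b0 : 0 < `|b| + 1 by rewrite ltr_wpDl // normr_ge0.
have e0 : 0 < x / 2 / (`|b| + 1) by rewrite divr_gt0 // divr_gt0.
have := H _ e0; apply/negP; rewrite -ltNge.
apply: (@le_lt_trans _ _ (x / 2 / (`|b| + 1) * (`|b| + 1))).
  by rewrite ler_wpM2l ?(ltW e0) // (le_trans (ler_norm _)) // lerDl.
by rewrite divfK ?gt_eqF //; lra.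
Qed.

(** One small [t > 0] suffices for each tolerance: the expansion bounds [t * 'd G z X] by a small
    multiple of [t], and [t] cancels. *)
Lemma diff_ray_cst (G : V -> R) z X : differentiable G z ->
  (\forall t \near 0^'+, G (z + t *: X) = G z) -> 'd G z X = 0.
Proof.
move=> dG GX; apply/eqP; rewrite -normr_le0.
apply: (@le0_eps _ `|X|) => e e0.
have [d d0 H] := differentiable_near dG e0.
have X1 : 0 < `|X| + 1 by rewrite ltr_wpDl // normr_ge0.
have d1 : 0 < d / (`|X| + 1) by rewrite divr_gt0.
near (0 : R)^'+ => t.
have t0 : 0 < t by [].
have GXt : G (z + t *: X) = G z by near: t.
have tX : `|t *: X| < d.
  rewrite normrZ gtr0_norm //; apply: (@le_lt_trans _ _ (t * (`|X| + 1))).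
    by rewrite ler_wpM2l ?(ltW t0) // lerDl.
  by rewrite -ltr_pdivlMr.
have := H _ tX; rewrite GXt subrr sub0r normrN linearZ /= !normrZ.
by rewrite mulrCA ler_pM2l // normr_gt0 gt_eqF.
Unshelve. all: by end_near. Qed.

(** A local equation is regular at its centre only, so moving the centre requires a nonzero
    differential at the new point. *)
Lemma local_equation_at (S O : set V) F z x X :
  local_equation S z O F -> O x -> 'd F x X != 0 -> local_equation S x O F.
Proof. by move=> [opO Oz smF HS _] Ox dX; split=> //; exists X. Qed.

(** Evaluating [f] at points [v + t *: (X + s *: Y)] of [S] with [s] small gives [0 <= f X]; the
    same holds for [- X]. *)
Lemma tangent_support (S : set V) v X (f : {linear V -> R^o}) :
  S v -> (forall x, S x -> 0 <= f x) -> f v = 0 -> tangent S v X -> f X = 0.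
Proof.
move=> Sv f0 fv [U [F [eqF dX]]].
have [Y dY] : exists Y, 'd F v Y != 0 by case: eqF.
suff pos X' : 'd F v X' = 0 -> 0 <= f X'.
  apply/eqP; rewrite eq_le pos // andbT -oppr_ge0 -linearN pos //.
  by rewrite linearN dX oppr0.
move=> {X}dX; rewrite -oppr_le0; apply: (@le0_eps _ `|f Y|) => e e0.
near (0 : R)^'+ => t.
have t0 : 0 < t by [].
have [s se /f0] : exists2 s : R, `|s| <= e & S (v + t *: (X' + s *: Y)).
  by near: t; exact: local_equation_curve eqF Sv dX dY e0.
rewrite formD fv add0r formZ pmulr_rge0 // formD formZ => h.
rewrite lerNl; apply: le_trans (_ : - (s * f Y) <= _); last by lra.
by rewrite lerN2 (le_trans (ler_norm _)) // normrM ler_wpM2r.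
Unshelve. all: by end_near. Qed.

End Ray.

(** * The convex cone bounded by a fiber, and its support forms *)

Section ConeFiber.
Context {R : realType} {m : nat}.
Local Notation V := 'rV[R]_m.
Context (C A : set V) (coneCA : cone_fiber C A).
Implicit Types (v w a k : V).

Lemma lightlike_bdry v : C v -> [/\ v != 0, closure A v & ~ A v].
Proof. by case: coneCA => _ _ _ CE _; rewrite {1}CE. Qed.

Lemma bdry_lightlike v : v != 0 -> closure A v -> ~ A v -> C v.
Proof. by case: coneCA => _ _ _ CE _ v0 Kv nAv; rewrite CE. Qed.

Lemma timelike_conv a b (t : R) : 0 <= t -> t <= 1 -> A a -> A b ->
  A (t *: a + (1 - t) *: b).
Proof.
case: coneCA => _ _ [_ cA _] _ _ t0 t1 Aa Ab.
by have := cA a b (Itv01 t0 t1); rewrite !inE; apply.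
Qed.

Lemma timelike_neq0 a : A a -> a != 0.
Proof. by case: coneCA => _ _ [_ _ A0] _ _ Aa; apply/eqP => a0; apply: A0;
  rewrite -a0. Qed.

Lemma lightlike_scale v (l : R) : 0 < l -> C v -> C (l *: v).
Proof. by case: coneCA => sC _ _ _ _ l0 Cv; exact: sC. Qed.

(* [A] cannot be left along a half-line issued from the origin: at the exit
   point the conic boundary [C] would be met, hence contain the half-line. *)
Lemma timelike_scale a (l : R) : 0 < l -> A a -> A (l *: a).
Proof.
move=> l0 Aa; have [_ _ [opA _ _] _ _] := coneCA.
have ct : continuous (fun t : R => t *: a).
  by move=> t; exact: (cvgZr_tmp cvg_id).
have conn : connected [set t : R | 0 < t].
  apply/connected_intervalP => x y /= x0 _ z /andP[xz _].
  exact: lt_le_trans xz.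
have := conn [set t : R | 0 < t /\ A (t *: a)].
have /[swap] /[apply] : [set t : R | 0 < t /\ A (t *: a)] !=set0.
  by exists 1; split=> //; rewrite scale1r.
move=> H; suff /seteqP[_ sub] : [set t : R | 0 < t /\ A (t *: a)] = [set t | 0 <
  t].
  by have [] := sub l l0.
apply: H.
  exists ((fun t : R => t *: a) @^-1` A); last by [].
  by apply: open_comp opA => t _; exact: ct.
exists ((fun t : R => t *: a) @^-1` closure A).
  by apply: closed_comp => [t _|]; [exact: ct|exact: closed_closure].
apply/seteqP; split=> t /= [t0 At]; split=> //; first exact: subset_closure.
apply: contrapT => nAt.
have Ct : C (t *: a).
  by apply: bdry_lightlike => //; rewrite scaler_eq0 gt_eqF //= timelike_neq0.
have := lightlike_scale (_ : 0 < t^-1) Ct; rewrite invr_gt0 => /(_ t0).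
by rewrite scalerA mulVf ?gt_eqF // scale1r => /lightlike_bdry[].
Qed.

Lemma timelikeD a b : A a -> A b -> A (a + b).
Proof.
move=> Aa Ab; have h0 : 0 <= 2^-1 :> R by rewrite invr_ge0.
have h1 : 2^-1 <= 1 :> R by rewrite invf_le1 ?ltr0n // ler1n.
have := timelike_scale (ltr0n _ 2) (timelike_conv h0 h1 Aa Ab).
have -> : 1 - 2^-1 = 2^-1 :> R by field.
by rewrite -scalerDr scalerA mulfV ?pnatr_eq0 // scale1r.
Qed.

(** Any [x] in [A] close enough to [k] leaves [a + k - x] in the open set [A]; then [k + a] is the
    sum of two timelike vectors. *)
Lemma closure_timelikeD k a : closure A k -> A a -> A (k + a).
Proof.
move=> Kk Aa; have [_ _ [opA _ _] _ _] := coneCA.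
have [x [Ax]] : A `&` ((fun x : V => (a + k) + (-1) *: x) @^-1` A) !=set0.
  apply: Kk; apply: open_nbhs_nbhs; split; last by rewrite /= scaleN1r addrK.
  by apply: open_comp opA => x _; exact: continuous_homothety.
by move=> /= /(timelikeD Ax); rewrite scaleN1r addrC subrK addrC.
Qed.

Lemma closureZ k (l : R) : 0 < l -> closure A k -> closure A (l *: k).
Proof.
move=> l0 Kk B nB.
have [x [Ax]] : A `&` ((fun x : V => 0 + l *: x) @^-1` B) !=set0.
  by apply: Kk; apply: (@continuous_homothety _ _ 0 l k); rewrite add0r.
rewrite /= add0r => Bx.
by exists (l *: x); split=> //; exact: timelike_scale.
Qed.

Lemma closureD k w : closure A k -> closure A w -> closure A (k + w).
Proof.
move=> Kk Kw B nB.
have [x [Ax]] : A `&` ((fun x : V => k + 1 *: x) @^-1` B) !=set0.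
  by apply: Kw; apply: (@continuous_homothety _ _ k 1 w); rewrite scale1r.
rewrite /= scale1r => Bx.
by exists (k + x); split=> //; exact: closure_timelikeD.
Qed.

(** Neither [k] nor [- k] can be timelike, since their sum 0 would be. If nonzero, both are
    lightlike, against the salience of [C]. *)
Lemma closure_salient k : closure A k -> closure A (- k) -> k = 0.
Proof.
move=> Kk Kn; apply: contrapT => /eqP k0.
have nA x : closure A (- x) -> ~ A x.
  by move=> Kx /(closure_timelikeD Kx); rewrite addNr => /timelike_neq0 /eqP.
have Ck : C k by apply: bdry_lightlike => //; exact: nA.
have Cn : C (- k).
  by apply: bdry_lightlike; rewrite ?oppr_eq0 //; apply: nA; rewrite opprK.
by case: coneCA => _ sal _ _ _; exact: sal Ck Cn.
Qed.

Lemma closure_cases k : closure A k -> [\/ k = 0, C k | A k].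
Proof.
move=> Kk; have [->|k0] := eqVneq k 0; first by constructor 1.
have [Ak|nAk] := EM (A k); first by constructor 3.
by constructor 2; exact: bdry_lightlike.
Qed.

(** For lightlike [v], such a form is determined up to a positive factor. *)
Definition support_form v (l : {linear V -> R^o}) : Prop :=
  [/\ continuous l, (forall a, A a -> 0 < l a), l v = 0 &
      forall X, tangent C v X <-> l X = 0].

Lemma support_form_ge0 v l k : C v -> support_form v l -> closure A k ->
  0 <= l k.
Proof.
move=> Cv [cl pos _ _] Kk; rewrite leNgt; apply/negP => lk.
have [x [/pos lx]] : A `&` (l @^-1` [set y : R | y < 0]) !=set0.
  apply: Kk; apply: open_nbhs_nbhs; split=> //.
  apply: (@open_comp _ _ l [set y : R | y < 0]); last exact: open_lt.
  by move=> x _; exact: cl.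
by move=> /= /lt_trans /(_ lx); rewrite ltxx.
Qed.

Context (hypC : hypersurface C).

(** The form is the differential of a local equation, up to sign: it kills [v] because [C] is conic,
    has no zero on [A], and so keeps one sign on the convex set [A]. *)
Lemma support_form_exists v : C v -> exists l, support_form v l.
Proof.
move=> Cv; have [U [F eqF]] := hypC Cv.
have [opU Uv _ _ [Y dY]] := eqF.
have dF := local_equation_differentiable eqF Uv.
have Fv : 'd F v v = 0.
  apply: diff_ray_cst => //.
  have [_ _ _ HS _] := eqF.
  near=> t.
  have t0 : 0 < t by [].
  have Ut : U (v + t *: v) by near: t; exact: open_line.
  rewrite (local_equation_val eqF Cv); apply/HS => //.
  rewrite -[v in v + _]scale1r -scalerDl; apply: lightlike_scale => //.
  by rewrite addr_gt0.
(* Otherwise [- a] is tangent, and [C] contains a point [v - t *: (a - s *: Y)] with [a - s *: Y] in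
   [A]. Adding back this timelike vector would make [v] timelike. *)
have nz a : A a -> 'd F v a != 0.
  move=> Aa; apply/eqP => da; have [_ _ [opA _ _] _ _] := coneCA.
  have : \forall s \near (0 : R), A (a + s *: - Y).
    apply: (@continuous_line _ _ a (- Y) 0).
    by rewrite scale0r addr0; exact: open_nbhs_nbhs.
  move=> /nbhs_normP[e /= e0 He].
  have da' : 'd F v (- a) = 0 by rewrite linearN da oppr0.
  have e2 : 0 < e / 2 by rewrite divr_gt0.
  near (0 : R)^'+ => t.
  have t0 : 0 < t by [].
  have [s se Cs] : exists2 s : R, `|s| <= e / 2 & C (v + t *: (- a + s *: Y)).
    by near: t; exact: local_equation_curve eqF Cv da' dY e2.
  have /(timelike_scale t0) : A (a - s *: Y).
    rewrite -scalerN; apply: He; rewrite /= sub0r normrN (le_lt_trans se) //.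
    by rewrite ltr_pdivrMr // ltr_pMr // ltr1n.
  have [_ Ks _] := lightlike_bdry Cs.
  move/(closure_timelikeD Ks).
  have -> : - a + s *: Y = - (a - s *: Y) by rewrite opprB addrC.
  by rewrite scalerN subrK; have [] := lightlike_bdry Cv.
have [_ Kv _] := lightlike_bdry Cv.
have [a0 [Aa0 _]] := Kv setT (filterT).
pose l : {linear V -> R^o} := Num.sg ('d F v a0) \*: 'd F v.
have lE X : l X = Num.sg ('d F v a0) * 'd F v X by [].
have l0 : 0 < l a0 by rewrite lE -normrEsg normr_gt0 nz.
have sg0 : Num.sg ('d F v a0) != 0 by rewrite sgr_eq0 nz.
exists l; split.
- have cd := diff_continuous dF; move=> x.
  exact: (@cvgZl_tmp _ R^o _ _ _ (Num.sg ('d F v a0)) _ _ (cd x)).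
- move=> a Aa; rewrite ltNge; apply/negP => la.
  have d0 : 0 < l a0 - l a by rewrite subr_gt0 (le_lt_trans la).
  (* The point where [l] vanishes on the segment from [a] to [a0]. *)
  pose k : R := l a0 / (l a0 - l a).
  have k0 : 0 <= k by rewrite divr_ge0 // ltW.
  have k1 : k <= 1 by rewrite ler_pdivrMr // mul1r lerDl oppr_ge0.
  have lk : l (k *: a + (1 - k) *: a0) = 0.
    have alg (x y : R) : y - x != 0 ->
      y / (y - x) * x + (1 - y / (y - x)) * y = 0 by move=> ?; field.
    by rewrite formD [l (_ *: a)]formZ formZ; apply: alg; rewrite gt_eqF.
  have /nz := timelike_conv k0 k1 Aa Aa0.
  by rewrite -(inj_eq (mulfI sg0)) mulr0 -lE lk eqxx.
- by rewrite lE Fv mulr0.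
- move=> X; rewrite (tangentP _ eqF Cv) lE; split=> [->|/eqP]; first
    by rewrite mulr0.
  by rewrite mulf_eq0 (negPf sg0) => /eqP.
Unshelve. all: by end_near. Qed.

End ConeFiber.

(** * Strong convexity: a support hyperplane meets the cone in one ray *)

Section StrictConvexity.
Context {R : realType} {m : nat}.
Local Notation V := 'rV[R]_m.
Context (C A : set V) (coneCA : cone_fiber C A) (hypC : hypersurface C).
Implicit Types (v w X Y : V).

Lemma support_form_tangent v l (f : {linear V -> R^o}) : C v ->
  support_form C A v l -> (forall x, C x -> 0 <= f x) -> f v = 0 ->
  exists c : R, forall X, f X = c * l X.
Proof.
move=> Cv [cl pos lv tl] f0 fv; apply: linear_ker_sub => [|X /tl].
  have [_ Kv _] := lightlike_bdry coneCA Cv.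
  have [a [Aa _]] := Kv setT filterT.
  by exists a; rewrite gt_eqF // pos.
exact: tangent_support.
Qed.

(** Used for the tangent field [Yt] of the next lemma, whose derivative along [w] is thus a multiple
    of the tangent vector it extends. *)
Lemma differentiable_scale_sub (M N : V -> R) (c : R) X Y v w :
  differentiable M v -> differentiable N v -> 'd N v w = 0 ->
  let Z := fun x => c *: (M x *: X - N x *: Y) in
  differentiable Z v /\ 'd Z v w = (c * 'd M v w) *: X.
Proof.
have scale (G : V -> R) (T : V) : differentiable G v ->
    is_diff v (fun x => G x *: T) (fun k => 'd G v k *: T).
  move=> dG.
  exact: (is_diff_comp (differentiableP dG) (is_diff_scalel (G v) T)).
move=> dM dN dNw Z.
have [dZ dZE] : is_diff v Z (fun k => c *: ('d M v k *: X - 'd N v k *: Y)).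
  exact: is_diffZ (is_diffB (scale _ X dM) (scale _ Y dN)).
by rewrite dZE dNw scale0r subr0 scalerA.
Qed.

(* If the support hyperplane at [v] contained another boundary direction [w],
   it would also be the support hyperplane at all [v + s w], [s >= 0]; hence
   fields tangent to [C] would have a tangent derivative along [w], and [w]
   would lie in the radical of the second fundamental form. *)
Lemma support_form_ray v l w : C v -> support_form C A v l -> closure A w ->
  l w = 0 -> exists2 c : R, 0 <= c & w = c *: v.
Proof.
move=> Cv sl Kw lw; have [cl pos lv tl] := sl.
have [v0 Kv nAv] := lightlike_bdry coneCA Cv.
have [U [F eqF]] := hypC Cv.
have [opU Uv smF HS _] := eqF.
have dF x (Ux : U x) := local_equation_differentiable eqF Ux.
have [_ _ _ _ /(_ v Cv)[xi [h [[nxi _] sff _ rad]]]] := coneCA.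
have dFE Y x : U x -> 'd F x Y = 'D_Y F x by move=> Ux; rewrite deriveE //;
  exact: dF.
have Nv : 'D_xi F v != 0.
  by apply/eqP; rewrite -dFE // => /(tangentP _ eqF Cv).
have dD Y : differentiable ('D_Y F) v by exact: (smF [:: Y]).
have Cvw s : 0 < s -> C (v + s *: w).
  move=> s0; apply: (bdry_lightlike coneCA).
  - apply: contra_neq v0 => vw0; apply: (closure_salient coneCA) => //.
    have -> : - v = s *: w by apply/eqP; rewrite eq_sym -addr_eq0 addrC vw0.
    exact: (closureZ coneCA).
  - by apply: (closureD coneCA) => //; exact: (closureZ coneCA).
  - by move=> /pos; rewrite formD formZ lv lw mulr0 addr0 ltxx.
have l_ge0 x : C x -> 0 <= l x.
  by move=> Cx; apply: support_form_ge0 sl _ => //; have [] :=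
    lightlike_bdry coneCA Cx.
(* At each [v + t *: w] the form [l] is a nonzero multiple of the local support form, so [Y] is
   tangent there and ['D_Y F] vanishes along the ray. *)
have Dtan Y : l Y = 0 -> 'd ('D_Y F) v w = 0.
  move=> lY; have DYv : 'D_Y F v = 0 by rewrite -dFE //;
    apply/(tangentP _ eqF Cv)/tl.
  apply: diff_ray_cst => //; near=> t.
  have t0 : 0 < t by [].
  have Ut : U (v + t *: w) by near: t; exact: open_line.
  have Ct := Cvw _ t0.
  rewrite DYv -dFE //; have [l' sl'] := support_form_exists coneCA hypC Ct.
  have [c lE] : exists c : R, forall X, l X = c * l' X.
    by apply: support_form_tangent sl' l_ge0 _ => //;
      rewrite formD formZ lv lw mulr0 addr0.
  have [a Aa] : exists a, A a.
    by have [a [Aa _]] := Kv setT filterT; exists a.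
  have c0 : c != 0.
    apply/eqP => c0; have := pos _ Aa; by rewrite lE c0 mul0r ltxx.
  have l'Y : l' Y = 0.
    by apply/eqP; have /eqP := lY; rewrite lE mulf_eq0 (negPf c0).
  have [_ _ _ tl'] := sl'.
  have [U' [F' [eqF' dF'Y]]] := (tl' Y).2 l'Y.
  (* Arguing by contradiction supplies the nonzero differential that makes [F] a local equation at
     [v + t *: w]. *)
  apply: contrapT => /eqP nD.
  have eqFt := local_equation_at eqF Ut nD.
  by move/eqP: nD; apply; exact: local_equation_tangent_sub eqF' eqFt Ct dF'Y.
have tw : tangent C v w by apply/tl.
have [c wE] : exists c : R, w = c *: v.
  apply/(rad w tw) => Y tY.
  have lY : l Y = 0 by apply/tl.
  have DYv : 'D_Y F v = 0 by rewrite -dFE //; apply/(tangentP _ eqF Cv).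
  pose n0 := 'D_xi F v.
  (* Correcting [Y] by a multiple of [xi] makes ['d F x (Yt x)] vanish identically near [v], and the
     correction is zero at [v]. *)
  pose Yt x := n0^-1 *: ('D_xi F x *: Y - 'D_Y F x *: xi).
  have Ytv : Yt v = Y by rewrite /Yt DYv scale0r subr0 scalerA mulVf ?scale1r.
  have tYt : \forall x \near v, C x -> tangent C x (Yt x).
    have nN : \forall x \near v, 'D_xi F x != 0.
      have nn : nbhs ('D_xi F v) [set y : R | y != 0].
        by apply: open_nbhs_nbhs; split=> //; exact: open_neq.
      exact: (differentiable_continuous (dD xi) nn).
    have nUv : nbhs v U by exact: open_nbhs_nbhs.
    near=> x => Cx.
    have Ux : U x by near: x.
    have Nx : 'd F x xi != 0 by rewrite dFE //; near: x.
    apply/(tangentP _ (local_equation_at eqF Ux Nx) Cx).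
    by rewrite /Yt formZ formBZ !dFE // ['D_xi F x * _]mulrC subrr mulr0.
  have [dYt dYtw] := differentiable_scale_sub n0^-1 Y xi (dD xi) (dD Y) (Dtan _
    lY).
  (* The derivative of [Yt] along [w] is tangent, so Gauss' formula leaves [h w Y *: xi] tangent; as
     [xi] is transverse, [h w Y = 0]. *)
  have := sff w Y Yt tw tY dYt Ytv tYt; rewrite dYtw => /tl.
  rewrite formBZ lY mulr0 sub0r => /eqP.
  rewrite oppr_eq0 mulf_eq0 => /orP[/eqP //|/eqP lxi].
  by case: nxi; apply/tl.
exists c => //; rewrite leNgt; apply/negP => c0.
move/eqP: v0; apply; apply: (closure_salient coneCA) => //.
have -> : - v = (- c)^-1 *: w
  by rewrite wE scalerA invrN mulNr mulVf ?scaleN1r // lt_eqF.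
by apply: (closureZ coneCA) => //; rewrite invr_gt0 oppr_gt0.
Unshelve. all: by end_near. Qed.

End StrictConvexity.

(** * The two sides of the hypersurface in a tangent space *)

Section HalfSpaces.
Context {R : realType} {m : nat} {Q : smooth_manifold R m}.
Local Notation V := 'rV[R]_m.

Lemma diff_ray_sign (F : V -> R) z v : differentiable F z -> F z = 0 ->
  'd F z v != 0 -> \forall t \near 0^'+, 0 < F (z + t *: v) * 'd F z v.
Proof.
move=> dF Fz dv; set c := 'd F z v.
have v1 : 0 < `|v| + 1 by rewrite ltr_wpDl // normr_ge0.
have e0 : 0 < `|c| / (`|v| + 1) by rewrite divr_gt0 // normr_gt0.
have [d d0 H] := differentiable_near dF e0.
have d1 : 0 < d / (`|v| + 1) by rewrite divr_gt0.
near=> t.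
have t0 : 0 < t by [].
have nv : `|t *: v| < t * (`|v| + 1).
  by rewrite normrZ gtr0_norm // ltr_pM2l // ltrDl.
have tv : `|t *: v| < d by apply: lt_trans nv _; rewrite -ltr_pdivlMr.
have Fc : `|F (z + t *: v) - t * c| < t * `|c|.
  have := H _ tv; rewrite Fz subr0 formZ => /le_lt_trans; apply.
  by rewrite -(ltr_pM2l e0) in nv;
    rewrite (lt_le_trans nv) // mulrCA divfK ?gt_eqF.
move: Fc; set a := F _; rewrite ltr_distl => /andP[ca ac].
have [c0|c0|c0] := ltgtP c 0.
- rewrite nmulr_lgt0 //; move: ac; rewrite ltr0_norm // mulrN subrr //.
- rewrite pmulr_lgt0 //; move: ca; rewrite gtr0_norm // subrr //.
- by move: dv; rewrite -/c c0 eqxx.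
Unshelve. all: by end_near. Qed.

(** With [closure Q1] given by [F <= 0], take [g] to be minus the differential of [F]. Its sign on
    [v] decides on which side the ray along [v] starts; disjointness of [Q1] and [Q2] gives the
    converse. *)
Lemma half_space_form (eta Q1 Q2 : set Q) p : divides eta Q1 Q2 -> eta p ->
  exists g : {linear V -> R^o},
    [/\ continuous g, exists x, g x != 0,
        forall X, tangent_at eta p X <-> g X = 0,
        forall v, half_space eta Q1 p v <-> 0 < g v &
        forall v, half_space eta Q2 p v <-> g v < 0].
Proof.
move=> [_ [op1 op2] [Q12 Qeta] _ [[_ _ sd] _]] etap.
have aphi := atlas_chart_at p; have dp := cdom_chart_at p.
have [_ opI _ _ _] := atlas_chart_axiom aphi.
have [U [F [eqF FQ]]] := sd _ _ aphi dp etap.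
set z := chart_at p p in eqF.
have Sz : chart_image (chart_at p) eta z by exists p.
have [opU Uz _ HS [Y dY]] := eqF.
have Fz := local_equation_val eqF Sz.
have dF := local_equation_differentiable eqF Uz.
have disj x : chart_image (chart_at p) Q1 x -> ~ chart_image (chart_at p) Q2 x.
  move=> [q [q1 dq] <-] [q' [q2 dq'] e].
  have : (Q1 `&` Q2) q by split=> //; rewrite -(chart_inj aphi dq' dq e).
  by rewrite Q12.
have cl12 q : closure Q1 q -> ~ Q2 q.
  move=> K1 q2; have [x] := K1 Q2 (open_nbhs_nbhs (conj op2 q2)).
  by rewrite Q12.
have cover q : ~ eta q -> Q1 q \/ Q2 q.
  by move=> neta; suff : (Q1 `|` Q2) q by []; rewrite Qeta.
have F1 x : U x -> F x < 0 -> chart_image (chart_at p) Q1 x.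
  move=> Ux Fx; have [q [K1 dq] qx] : chart_image (chart_at p) (closure Q1) x.
    by apply/FQ => //; exact: ltW.
  exists q => //; split=> //; have [|//|/(cl12 _ K1)//] := cover q.
  move=> etaq; have /(HS _ Ux) Fx0 : chart_image (chart_at p) eta x by exists q.
  by move: Fx; rewrite Fx0 ltxx.
have F2 x : U x -> chart_image (chart_at p) setT x -> 0 < F x ->
    chart_image (chart_at p) Q2 x.
  move=> Ux [q [_ dq] qx] Fx; exists q => //; split=> //.
  have [|q1|//] := cover q.
    move=> etaq; have /(HS _ Ux) Fx0 : chart_image (chart_at p) eta x
      by exists q.
    by move: Fx; rewrite Fx0 ltxx.
  have /(FQ _ Ux) : chart_image (chart_at p) (closure Q1) x.
    by exists q => //; split=> //; exact: subset_closure.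
  by move=> /(lt_le_trans Fx); rewrite ltxx.
have Iz : chart_image (chart_at p) setT z by exists p.
have nUI v : \forall t \near (0 : R)^'+,
    U (z + t *: v) /\ chart_image (chart_at p) setT (z + t *: v).
  by apply: (@open_line _ _ (U `&` chart_image _ setT)) => //; exact: openI.
have ray1 v : 'd F z v < 0 ->
    \forall t \near (0 : R)^'+, chart_image (chart_at p) Q1 (z + t *: v).
  move=> dv; have dv0 : 'd F z v != 0 by rewrite lt_eqF.
  apply: filterS2 (nUI v) (diff_ray_sign dF Fz dv0) => t [Ut _].
  by rewrite nmulr_lgt0 // => /(F1 _ Ut).
have ray2 v : 0 < 'd F z v ->
    \forall t \near (0 : R)^'+, chart_image (chart_at p) Q2 (z + t *: v).
  move=> dv; have dv0 : 'd F z v != 0 by rewrite gt_eqF.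
  apply: filterS2 (nUI v) (diff_ray_sign dF Fz dv0) => t [Ut It].
  by rewrite pmulr_lgt0 // => /(F2 _ Ut It).
have tanE X : tangent_at eta p X <-> 'd F z X = 0 by exact: tangentP eqF Sz.
pose g : {linear V -> R^o} := -1 \*: 'd F z.
have gE X : g X = - 'd F z X :> R by rewrite -mulN1r.
exists g; split.
- have cd := diff_continuous dF; move=> x.
  exact: (@cvgZl_tmp _ R^o _ _ _ (-1) _ _ (cd x)).
- by exists Y; rewrite gE oppr_eq0.
- by move=> X; rewrite tanE gE; split=> [->|/eqP];
    rewrite ?oppr0 // oppr_eq0 => /eqP.
- move=> v; rewrite gE oppr_gt0; split=> [[nT h]|dv]; last first.
    by split; [move/tanE/eqP; rewrite lt_eqF|exact: ray1].
  have [//|dv|dv] := ltgtP ('d F z v) 0; last by case: nT; apply/tanE.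
  by have [t [h1 /(disj _ h1)]] := filter_ex (filterI h (ray2 _ dv)).
- move=> v; rewrite gE oppr_lt0; split=> [[nT h]|dv]; last first.
    by split; [move/tanE/eqP; rewrite gt_eqF|exact: ray2].
  have [dv|//|dv] := ltgtP ('d F z v) 0; last by case: nT; apply/tanE.
  by have [t [h1 /disj]] := filter_ex (filterI (ray1 _ dv) h).
Unshelve. all: by end_near. Qed.

End HalfSpaces.

(** * Existence and uniqueness of the transverse reflection *)

Section Reflections.
Context {R : realType} {m : nat}.
Local Notation V := 'rV[R]_m.
Context (C A : set V) (coneCA : cone_fiber C A) (hypC : hypersurface C).
Implicit Types (u v w X : V) (l g : {linear V -> R^o}).

Lemma support_form_lightlike0 v l w : C v -> support_form C A v l -> C w ->
  l w = 0 -> same_direction v w.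
Proof.
move=> Cv sl Cw lw; have [w0 Kw _] := lightlike_bdry coneCA Cw.
have [c c0 wE] := support_form_ray coneCA hypC Cv sl Kw lw.
exists c => //; rewrite lt_def c0 andbT.
by apply: contra_neq w0 => ce; rewrite wE ce scale0r.
Qed.

Lemma lightlike_timelike v : C v -> exists a, A a.
Proof.
move=> /(lightlike_bdry coneCA)[_ Kv _].
by have [a [Aa _]] := Kv setT filterT; exists a.
Qed.

Lemma support_form_lightlike_ge0 v l w : C v -> support_form C A v l ->
  C w -> 0 <= l w.
Proof.
move=> Cv sl /(lightlike_bdry coneCA)[_ Kw _].
exact: support_form_ge0 Cv sl Kw.
Qed.

Lemma support_form_kerE v l (f : {linear V -> R^o}) : C v ->
  support_form C A v l -> (forall x, C x -> 0 <= f x) -> f v = 0 ->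
  (exists x, f x != 0) -> forall X, f X = 0 <-> l X = 0.
Proof.
move=> Cv sl f0 fv [x fx].
have [c fE] := support_form_tangent coneCA Cv sl f0 fv.
have c0 : c != 0 by apply: contra_neq fx => c0; rewrite fE c0 mul0r.
move=> X; rewrite fE; split=> [/eqP|->]; last by rewrite mulr0.
by rewrite mulf_eq0 (negPf c0) => /eqP.
Qed.

Lemma closureA_unit_compact g : continuous g ->
  compact (closure A `&` [set k | `|k| = 1] `&` [set k | 0 <= g k]).
Proof.
move=> cg; apply: bounded_closed_compact.
  exists 1; split=> // M M1 k [[_ /= ->] _]; exact: ltW.
apply: closedI; last first.
  apply: (@closed_comp _ _ g [set y : R | 0 <= y]); last exact: closed_ge.
  by move=> x _; exact: cg.
apply: closedI; first exact: closed_closure.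
apply: (@closed_comp _ _ (fun k : V => `|k|) [set y : R | y = 1]);
  last exact: closed_eq.
by move=> x _; exact: norm_continuous.
Qed.

(* Modulo the intersection of [ker l] and [ker g], the cone is a planar sector
   with one side along [u]; [w] spans the other side. *)
Lemma extremal_slope u l g a : C u -> support_form C A u l -> continuous g ->
  A a -> g a = 0 -> g u < 0 -> (exists x, g x != 0) ->
  exists w, [/\ C w, 0 < g w, 0 < l w &
    forall k, closure A k -> l w * g k <= g w * l k].
Proof.
move=> Cu sl cg Aa ga gu [d gd]; have [cl pos lu tl] := sl.
have l_ge0 k : closure A k -> 0 <= l k by exact: support_form_ge0 Cu sl.
(* By strong convexity [l] vanishes on the closed cone only along [u], where [g] is negative. So
   [g / l] is defined on the compact set [E]. *)
have l_gt0 k : closure A k -> k != 0 -> 0 <= g k -> 0 < l k.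
  move=> Kk k0 gk; rewrite lt_def l_ge0 // andbT; apply/eqP => lk.
  have [c c0 kE] := support_form_ray coneCA hypC Cu sl Kk lk.
  move: gk; rewrite kE formZ nmulr_lge0 // => c0'.
  have ce : c = 0 by apply/eqP; rewrite eq_le c0 c0'.
  by move: k0; rewrite kE ce scale0r eqxx.
pose E := closure A `&` [set k | `|k| = 1] `&` [set k | 0 <= g k].
have normE k : closure A k -> k != 0 -> 0 <= g k -> E (`|k|^-1 *: k).
  move=> Kk k0 gk; have nk : 0 < `|k| by rewrite normr_gt0.
  split; [split|] => /=.
  - by apply: (closureZ coneCA) => //; rewrite invr_gt0.
  - by rewrite normrZ gtr0_norm ?invr_gt0 // mulVf // gt_eqF.
  - by rewrite formZ mulr_ge0 // invr_ge0 ltW.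
have E_gt0 k : E k -> 0 < l k.
  move=> [[Kk /= k1] gk]; apply: l_gt0 => //.
  by rewrite -normr_gt0 k1.
have KA := @subset_closure _ A.
have [w Ew wmax] : exists2 w, w \in E
  & forall k, k \in E -> g k / l k <= g w / l w.
  apply: compact_EVT_max.
  - by exists (`|a|^-1 *: a); apply: normE;
      rewrite ?ga ?(timelike_neq0 coneCA) //; exact: KA.
  - exact: closureA_unit_compact.
  - apply: continuous_in_subspaceT => k; rewrite inE => Ek.
    have lk : l k != 0 by rewrite gt_eqF // E_gt0.
    exact: (@cvgM R _ _ _ g (fun x => (l x)^-1) (g k) (l k)^-1 (cg k)
      (@cvgV R _ _ _ l (l k) lk (cl k))).
rewrite inE in Ew; have [[Kw /= w1] gw] := Ew; have lw := E_gt0 _ Ew.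
have w0 : w != 0 by rewrite -normr_gt0 w1.
have slope k : closure A k -> l w * g k <= g w * l k.
  move=> Kk; have [gk|gk] := ltP (g k) 0.
    apply: (@le_trans _ _ 0); first by rewrite pmulr_rle0 // ltW.
    by rewrite mulr_ge0 // l_ge0.
  have [->|k0] := eqVneq k 0; first by rewrite !linear0 !mulr0.
  have Ek := normE _ Kk k0 gk.
  have nk : `|k|^-1 != 0 by rewrite invr_eq0 normr_eq0.
  have := wmax (`|k|^-1 *: k); rewrite inE => /(_ Ek).
  rewrite !formZ -mulf_div divff // mul1r ler_pdivrMr ?l_gt0 //.
  by rewrite mulrAC ler_pdivlMr // mulrC.
exists w; split=> //.
(* A timelike [w] could be moved by a small multiple of [- u], which keeps [l] and raises [g],
   against maximality. *)
- apply: (bdry_lightlike coneCA) => // Aw.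
  have [_ _ [opA _ _] _ _] := coneCA.
  near (0 : R)^'+ => t.
  have t0 : 0 < t by [].
  have /KA/slope : A (w + t *: - u) by near: t; exact: open_line.
  rewrite !formD !formZ !linearN lu oppr0 mulr0 addr0 mulrDr mulrC.
  rewrite gerDl pmulr_rle0 // pmulr_rle0 // oppr_le0.
  by move=> /(lt_le_trans gu); rewrite ltxx.
(* Pushing [a] slightly along [b] gives a timelike vector with [g] positive, so the maximal slope is
   positive. *)
- have [_ _ [opA _ _] _ _] := coneCA.
  pose b := (Num.sg (g d)) *: d.
  have gb : 0 < g b by rewrite formZ -normrEsg normr_gt0.
  near (0 : R)^'+ => t.
  have t0 : 0 < t by [].
  have At : A (a + t *: b) by near: t; exact: open_line.
  have := slope _ (KA _ At); rewrite [g (_ + _)]formD ga add0r formZ => h.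
  by rewrite -(pmulr_lgt0 _ (pos _ At)) (lt_le_trans _ h) // !mulr_gt0.
Unshelve. all: by end_near. Qed.

(** The form [g w * l - l w * g] is nonnegative on the cone and zero at the extremal [w], so its
    kernel is the tangent space there. For another solution [w'], with support form
    [al * l + be * g], positivity at [u] and [w] forces [be < 0] and a slope at least that of [w];
    hence [w'] lies in that same kernel. *)
Lemma reflection_exists u l g a : C u -> support_form C A u l -> continuous g ->
  A a -> g a = 0 -> g u < 0 -> (exists x, g x != 0) ->
  exists w, [/\ C w, 0 < g w,
    (forall X, l X = 0 -> g X = 0 -> tangent C w X) &
    forall w', C w' -> 0 <= g w' ->
      (forall X, l X = 0 -> g X = 0 -> tangent C w' X) -> same_direction w w'].
Proof.
move=> Cu sl cg Aa ga gu gn0; have [cl pos lu tl] := sl.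
have [w [Cw gw lw slope]] := extremal_slope Cu sl cg Aa ga gu gn0.
pose f : {linear V -> R^o} := g w \*: l \- l w \*: g.
have fE X : f X = g w * l X - l w * g X :> R by [].
have [lw' sw] := support_form_exists coneCA hypC Cw.
have [_ _ _ tw] := sw.
have fker X : f X = 0 <-> lw' X = 0.
  apply: (support_form_kerE Cw sw).
  - by move=> x /(lightlike_bdry coneCA)[_ Kx _]; rewrite fE subr_ge0 slope.
  - by rewrite fE [l w * _]mulrC subrr.
  - by exists u; rewrite fE lu mulr0 sub0r oppr_eq0 mulf_neq0 ?(gt_eqF lw)
      ?(lt_eqF gu).
exists w; split=> //.
  by move=> X lX gX; apply/tw/fker; rewrite fE lX gX !mulr0 subrr.
move=> w' Cw' gw' perp.
apply: (support_form_lightlike0 Cw sw Cw'); apply/fker.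
have [l' sl'] := support_form_exists coneCA hypC Cw'.
have [_ pos' l'w' tl'] := sl'.
have [al [be l'E]] : exists a b : R, forall x, l' x = a * l x + b * g x.
  apply: linear_ker2_sub => //; last by move=> x lx gx; apply/tl'/perp.
  by exists a => //; rewrite gt_eqF // pos.
have lw'0 : 0 < l w'.
  rewrite lt_def (support_form_lightlike_ge0 Cu sl Cw') andbT;
    apply/eqP => lw'0.
  have [c c0 wE] := support_form_lightlike0 Cu sl Cw' lw'0.
  by move: gw'; rewrite wE formZ pmulr_rge0 // => /(lt_le_trans gu);
    rewrite ltxx.
have be0 : be <= 0.
  have := support_form_lightlike_ge0 Cw' sl' Cu.
  by rewrite l'E lu mulr0 add0r nmulr_lge0.
have bal : al * l w' + be * g w' = 0 by rewrite -l'E.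
have be1 : be < 0.
  rewrite lt_def be0 andbT eq_sym; apply/eqP => bee.
  move/eqP: bal; rewrite bee mul0r addr0 mulf_eq0 (gt_eqF lw'0) orbF => /eqP
    ale.
  by have := pos' _ Aa; rewrite l'E bee ale !mul0r addr0 ltxx.
have l'w : 0 <= al * l w + be * g w.
  by rewrite -l'E; exact: support_form_lightlike_ge0 Cw' sl' Cw.
have [_ Kw' _] := lightlike_bdry coneCA Cw'.
apply/eqP; rewrite eq_le fE subr_le0 subr_ge0 slope // andbT.
have alE : al * l w' = - (be * g w') by apply/eqP; rewrite -addr_eq0 bal.
(* Multiply [l'w] by [l w'] and eliminate [al] through [l' w' = 0]. *)
have : 0 <= be * (g w * l w' - l w * g w').
  have -> : be * (g w * l w' - l w * g w') = (al * l w + be * g w) * l w'.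
    by rewrite mulrDl mulrAC alE; ring.
  by rewrite mulr_ge0 // ltW.
by rewrite nmulr_rge0 // subr_le0.
Qed.

End Reflections.

(** * The case analysis in a single tangent space *)

Section ConeReflection.
Context {R : realType} {m : nat}.
Local Notation V := 'rV[R]_m.
Context (C A : set V) (coneC : cone_fiber C A) (hypC : hypersurface C).
Context (T half : set V) (g : {linear V -> R^o}) (cg : continuous g)
  (gn0 : exists x, g x != 0) (tg : forall X, T X <-> g X = 0)
  (gpos : forall X, half X <-> 0 < g X).
Context (u : V) (Cu : C u) (gu : g u <= 0).

Let Pi_u := orthogonal_complement C u `&` T.
Let reflected w := [/\ C w, half w \/ T w & Defs.orthogonal C w Pi_u].

Lemma cone_reflection :
  (orthogonal_complement C u <> T ->
    [/\ timelike_subspace A T ->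
          [/\ ~ timelike_subspace A Pi_u,
              spacelike_subspace C A Pi_u ->
                exists_unique_direction reflected /\
                (forall w, reflected w -> ~ T w) &
              lightlike_subspace C Pi_u ->
                exists_unique_direction reflected /\
                (forall w, reflected w -> T w /\ same_direction u w)],
        lightlike_subspace C T ->
          exists_unique_direction reflected /\
          (forall w, reflected w -> T w) &
        spacelike_subspace C A T -> forall w, ~ reflected w]) /\
  (~ (orthogonal_complement C u <> T) ->
    exists_unique_direction reflected /\
    (forall w, reflected w -> T w /\ same_direction u w)).
Proof.
have sup := support_form_exists coneC hypC.
have [l sl] := sup _ Cu; have [_ pos lu tl] := sl.
have refE w : reflected w <-> [/\ C w, 0 <= g w &
    forall X, l X = 0 -> g X = 0 -> tangent C w X].
  split=> [[Cw hw perp]|[Cw gw perp]]; split=> //.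
  - by case: hw => [/gpos/ltW //|/tg ->].
  - by move=> X lX gX; apply: perp; split; [apply/tl|apply/tg].
  - by move: gw; rewrite le_eqVlt => /orP[/eqP/esym/tg|/gpos]; [right|left].
  - by move=> X [/tl lX /tg gX]; exact: perp.
(* Shared by the case of lightlike [Pi_u] and the case where [T] is the tangent hyperplane at
   [u]. *)
have tangential : g u = 0 -> exists_unique_direction reflected /\
    (forall w, reflected w -> T w /\ same_direction u w).
  move=> gu0; have same w : reflected w -> same_direction u w.
    move=> /refE[Cw gw perp]; have [lw sw] := sup _ Cw; have [_ _ _ tw] := sw.
    have [c c0 uE] := support_form_lightlike0 coneC hypC Cw sw Cu
      ((tw u).1 (perp _ lu gu0)).
    by exists c^-1; rewrite ?invr_gt0 // uE scalerA mulVf ?scale1r // gt_eqF.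
  split; last first.
    move=> w rw; split; last exact: same.
    by have [c _ ->] := same _ rw; apply/tg; rewrite formZ gu0 mulr0.
  exists u => //; apply/refE; split=> //; first by rewrite gu0.
  by move=> X lX _; apply/tl.
split=> [trv|ntrv]; last first.
  apply: tangential; apply/tg.
  have -> : T = orthogonal_complement C u.
    by apply: esym; apply: contrapT => H; apply: ntrv => e; exact: H.
  exact/tl.
split=> [[a Ta Aa]|[v [Cv /tg gv sub]]|spT].
- have /tg ga := Ta; split.
  + by move=> [x [/tl lx _] /pos]; rewrite lx ltxx.
  (* If [g u = 0], the lightlike [u] itself would lie in [Pi_u]. *)
  + move=> spPi; have gu0 : g u < 0.
      rewrite lt_def gu andbT; apply/eqP => gu0.
      have [|nc _] := spPi u; last by apply: nc; right.
      by split; [apply/tl|apply/tg].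
    have [w [Cw gw perp uniq]] :=
      reflection_exists coneC hypC Cu sl cg Aa ga gu0 gn0.
    have same w' : reflected w' -> same_direction w w'.
      by move=> /refE[Cw' gw' perp']; exact: uniq.
    have rw : reflected w by apply/refE; split;
      [exact: Cw|exact: ltW|exact: perp].
    split; first by exists w; [exact: rw|exact: same].
    move=> w' /same[c c0 ->] /tg; rewrite formZ => /eqP cgw.
    by have := mulr_gt0 c0 gw; rewrite (eqP cgw) ltxx.
  + move=> [v [Cv [/tl lv /tg gv] _]]; apply: tangential.
    have [c c0 vE] := support_form_lightlike0 coneC hypC Cu sl Cv lv.
    by apply/eqP; have /eqP := gv; rewrite vE formZ mulf_eq0 (gt_eqF c0).
- have [lv sv] := sup _ Cv; have [_ posv lvv tv] := sv.
  have [c lvE] : exists c : R, forall X, lv X = c * g X.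
    by apply: linear_ker_sub gn0 _ => X /tg/sub/tv.
  have [a Aa] := lightlike_timelike coneC Cv.
  have c0 : c != 0 by apply/eqP => c0; have := posv _ Aa;
    rewrite lvE c0 mul0r ltxx.
  have lv_ge0 w : C w -> 0 <= lv w :=
    support_form_lightlike_ge0 coneC Cv sv (w := w).
  (* If [lv u = 0], then [l] and [lv] have the same kernel, which is [T], against transversality.
     With [g u <= 0] this makes [c] negative, so [g <= 0] on [C] and a reflected [w] satisfies
     [lv w = 0]. *)
  have lvu : 0 < lv u.
    rewrite lt_def lv_ge0 // andbT; apply/eqP => lvu; apply: trv.
    have kerE := support_form_kerE coneC Cu sl lv_ge0 lvu.
    apply/seteqP; split=> X.
      move=> /tl/kerE H; apply/tg/(mulfI c0); rewrite mulr0 -lvE; apply: H.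
      by exists a; rewrite gt_eqF // posv.
    by move=> /sub/tv/kerE H; apply/tl/H; exists a; rewrite gt_eqF // posv.
  have cneg : c < 0.
    rewrite ltNge; apply/negP => cpos; move: lvu; rewrite lvE ltNge => /negP;
      apply.
    by rewrite mulr_ge0_le0.
  have ref0 w : reflected w -> same_direction v w.
    move=> /refE[Cw gw _]; apply: (support_form_lightlike0 coneC hypC Cv sv Cw).
    by apply/eqP; rewrite eq_le lv_ge0 // andbT lvE nmulr_rle0.
  split.
    exists v => //; apply/refE; split=> //; first by rewrite gv.
    by move=> X _ gX; apply/sub/tg.
  by move=> w /ref0[d _ ->]; apply/tg; rewrite formZ gv mulr0.
- move=> w /refE[Cw gw _].
  have nT k : C k -> g k != 0.
    move=> Ck; apply/eqP => /tg /spT[nc _]; apply: nc; right; exact: Ck.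
  have gu0 : 0 < - g u by rewrite oppr_gt0 lt_neqAle gu nT.
  have gw0 : 0 < g w by rewrite lt_def gw nT.
  have [u0 Ku _] := lightlike_bdry coneC Cu; have [_ Kw _] :=
    lightlike_bdry coneC Cw.
  have Ku' := closureZ coneC gw0 Ku; have Kw' := closureZ coneC gu0 Kw.
  (* This positive combination of [u] and [w] lies in [T] and in the closed cone. Salience prevents
     it from being 0, so it is causal, which a spacelike [T] excludes. *)
  have /tg /spT[nc _] : g (g w *: u + - g u *: w) = 0.
    by rewrite formD !formZ mulNr [g w * _]mulrC subrr.
  have [k0|Ck|Ak] := closure_cases coneC (closureD coneC Ku' Kw').
  + have : g w *: u = 0.
      apply: (closure_salient coneC Ku').
      by have -> : - (g w *: u) = - g u *: w by apply/eqP;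
        rewrite eq_sym -addr_eq0 addrC k0.
    by move/eqP; rewrite scaler_eq0 (negPf u0) (gt_eqF gw0).
  + by apply: nc; right.
  + by apply: nc; left.
Qed.

End ConeReflection.

(** * Reduction to the tangent space at [p] *)

Theorem corollary5p7 (R : realType) (n : nat) (Q : smooth_manifold R n.+1)
    (eta Q1 Q2 : set Q) (C1 A1 : Q -> set 'rV[R]_n.+1)
    (p : Q) (u : 'rV[R]_n.+1)
    (dimQ : (3 <= n.+1)%N)
    (etaQ : divides eta Q1 Q2)
    (coneC1 : extendable_cone_structure_on (closure Q1) C1 A1)
    (etap : eta p)
    (incu : incident_direction eta Q2 C1 p u) :
  let Teta := tangent_at eta p in
  let Pi_u := hypersurface_trace eta C1 p u in
  let reflected := reflected_direction eta Q1 C1 p u in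
  (cone_transverse eta C1 p u ->
    [/\ (* A* *)
        timelike_subspace (A1 p) Teta ->
          [/\ ~ timelike_subspace (A1 p) Pi_u,
              spacelike_subspace (C1 p) (A1 p) Pi_u ->
                exists_unique_direction reflected /\
                (forall w, reflected w -> ~ Teta w) &
              lightlike_subspace (C1 p) Pi_u ->
                exists_unique_direction reflected /\
                (forall w, reflected w -> Teta w /\ same_direction u w)],
        (* B* *)
        lightlike_subspace (C1 p) Teta ->
          exists_unique_direction reflected /\
          (forall w, reflected w -> Teta w) &
        (* C* *)
        spacelike_subspace (C1 p) (A1 p) Teta ->
          forall w, ~ reflected w]) /\
  (~ cone_transverse eta C1 p u ->
    exists_unique_direction reflected /\
    (forall w, reflected w -> Teta w /\ same_direction u w)).
Proof.
have K1p : closure Q1 p by have [_ _ _ _ [[sub _ _] _]] := etaQ; exact: sub.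
have [hypC coneC] : hypersurface (C1 p) /\ cone_fiber (C1 p) (A1 p).
  have [W [C' [A' [_ sub cs E]]]] := coneC1.
  by have [<- <-] := E _ K1p; apply: cone_structure_fiber cs _; exact: sub.
have [g [cg gn0 tg gpos gneg]] := half_space_form etaQ etap.
have [Cu gu] : C1 p u /\ g u <= 0.
  by case: incu => Cu hu; split=> //; case: hu => [/gneg/ltW //|/tg ->].
exact: (cone_reflection coneC hypC cg gn0 tg gpos Cu gu).
Qed.
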